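(* For every constant $\epsilon>0$, every algorithm for \textsc{Mono-Sub-MP} that achieves an approximation factor of $\frac{10}{9}-\epsilon$ requires $2^{\Omega(n)}$ function evaluation queries, where $n$ is the size of the ground set.
   Context: An instance of \textsc{Mono-Sub-MP} consists of a finite ground set $V$ with $|V|=n$, a non-negative, normalized ($f(\emptyset)=0$), monotone, submodular set function $f:2^V\to\mathbb{R}_{\ge 0}$ accessible only through an evaluation oracle (a query on $S\subseteq V$ returns $f(S)$), and $k$ distinct terminals $t_1,\dots,t_k\in V$. The goal is to find a partition $V_1,\dots,V_k$ of $V$ with $t_i\in V_i$ for all $i$ minimizing $\sum_{i=1}^k f(V_i)$. An algorithm achieves approximation factor $\beta$ if it always returns a feasible partition of cost at most $\beta$ times the optimum (randomized algorithms: with constant success probability/in expectation). *)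

(* Defs.v *)
From HB Require Import structures.
From mathcomp Require Import all_boot all_order all_algebra.
From mathcomp Require Import all_classical all_reals all_analysis.

Set Implicit Arguments.
Unset Strict Implicit.
Unset Printing Implicit Defensive.

Import Order.TTheory GRing.Theory Num.Theory.
Local Open Scope ring_scope.

Section MonoSubMP.
Context {R : realType}.
Implicit Types (V : finType) (k : nat) (beta p : R).

Definition normalized V (f : {set V} -> R) := f finset.set0 = 0.

Definition nonnegative V (f : {set V} -> R) := forall A, 0 <= f A.

Definition monotone_setfun V (f : {set V} -> R) :=
  forall A B : {set V}, A \subset B -> f A <= f B.

Definition submodular V (f : {set V} -> R) :=
  forall A B : {set V}, f (A :|: B) + f (A :&: B) <= f A + f B.

(* At least one terminal is required: for k = 0 and V nonempty there is no
   partition to look for. *)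
Definition mono_sub_mp V k (t : 'I_k -> V) (f : {set V} -> R) : Prop :=
  [/\ (0 < k)%N, injective t, normalized f, nonnegative f
    & monotone_setfun f /\ submodular f].

Definition parts V k := {ffun 'I_k -> {set V}}.

Definition feasible V k (t : 'I_k -> V) (P : parts V k) : bool :=
  [&& \bigcup_i P i == [set: V],
      [forall i, forall j, (i != j) ==> [disjoint P i & P j]]
    & [forall i, t i \in P i]].

Definition cost V k (f : {set V} -> R) (P : parts V k) : R := \sum_i f (P i).

(* On an instance the infimum is a minimum, over a finite nonempty set. *)
Definition opt V k (t : 'I_k -> V) (f : {set V} -> R) : R :=
  inf [set cost f P | P in [set` feasible t]]%classic.

(* A deterministic adaptive query algorithm on given V and k, with unlimited
   computation between queries: the next step depends on all answers so far. *)
Inductive query_tree V k : Type :=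
  | Return of parts V k
  | Query of {set V} & (R -> query_tree V k).

Fixpoint answer V k (f : {set V} -> R) (q : query_tree V k) : parts V k :=
  match q with
  | Return P => P
  | Query A next => answer f (next (f A))
  end.

Fixpoint nqueries V k (f : {set V} -> R) (q : query_tree V k) : nat :=
  match q with
  | Return _ => 0%N
  | Query A next => (nqueries f (next (f A))).+1
  end.

(* A randomized algorithm draws a seed from an arbitrary probability space and
   then follows the query tree determined by the ground set, the terminals and
   the seed.  A deterministic algorithm is one whose seed space is a point. *)
Record algorithm : Type := Algorithm {
  seed_display : measure_display;
  seed : measurableType seed_display;
  seed_law : probability seed R;
  tree : forall V k, ('I_k -> V) -> seed -> query_tree V k;
  measurable_answer : forall V k (t : 'I_k -> V) (f : {set V} -> R),
    mono_sub_mp t f ->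
    forall P, measurable [set w | answer f (tree t w) = P]%classic;
  measurable_nqueries : forall V k (t : 'I_k -> V) (f : {set V} -> R),
    mono_sub_mp t f ->
    forall m, measurable [set w | nqueries f (tree t w) = m]%classic
}.

Definition output (A : algorithm) V k (t : 'I_k -> V) (f : {set V} -> R)
  (w : seed A) : parts V k := answer f (tree t w).

Definition success beta (A : algorithm) V k (t : 'I_k -> V)
  (f : {set V} -> R) : set (seed A) :=
  [set w | feasible t (output t f w) /\
           cost f (output t f w) <= beta * opt t f]%classic.

Arguments success : clear implicits.
Arguments success beta A {V k} t f.

Definition approx_with_probability p beta (A : algorithm) : Prop :=
  forall V k (t : 'I_k -> V) (f : {set V} -> R), mono_sub_mp t f ->
  (p%:E <= seed_law A (success beta A t f))%E.

Definition approx_in_expectation beta (A : algorithm) : Prop :=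
  forall V k (t : 'I_k -> V) (f : {set V} -> R), mono_sub_mp t f ->
  {ae seed_law A, forall w, feasible t (output t f w)} /\
  ('E_(seed_law A)[fun w => cost f (output t f w)] <= (beta * opt t f)%:E)%E.

Definition expected_queries (A : algorithm) V k (t : 'I_k -> V)
  (f : {set V} -> R) : \bar R :=
  ('E_(seed_law A)[fun w => (nqueries f (tree t w))%:R])%E.

End MonoSubMP.

Arguments algorithm : clear implicits.
Arguments query_tree : clear implicits.

(* Main.v *)
Require Import Defs.
From HB Require Import structures.
From mathcomp Require Import all_boot all_order all_algebra.
From mathcomp Require Import reals.
From mathcomp Require Import zify ring lra.

Set Implicit Arguments.
Unset Strict Implicit.
Unset Printing Implicit Defensive.

Import Order.TTheory GRing.Theory Num.Theory.

(** Take three terminals and three clusters of 2m elements, one for each pair of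
terminals. In the visible function, a terminal is a generic flat of rank 2m in
the span of the two clusters at it, so that
f(S + t_i) = |S| + min(2m, |star i \ S|), and every feasible partition costs at
least 10m. In the hidden function each cluster is randomly divided between its
two terminals, and the flat of t_i meets the span of its own half in rank m - l;
giving every terminal its own half costs only 9m + 3l. Both functions are ranks
of (weighted) transversal matroids, hence monotone submodular, and they agree on
every set that the random division splits evenly up to a small linear error. By a
Chernoff bound a given query separates them with exponentially small
probability, so an algorithm run on the visible function with few queries
returns the same partition on most hidden functions, where it is too expensive. *)

(** * Minimal covers and submodularity *)

Section Rank.
Context {V U : finType} (core : {set V} -> {set V}) (act : {set V} -> {set U}).
Context (N : U -> {set V}) (w : U -> nat).

(* With unit weights, the minimum over [B] is the rank of [act S], with [core S]
   adjoined, in the transversal matroid in which [b] is a generic point of the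
   flat spanned by [N b]: Koenig's formula. *)
Definition rank_bound (S : {set V}) (B : {set U}) : nat :=
  #|core S :|: \bigcup_(b in B) N b| + \sum_(b in act S :\: B) w b.

Definition rank (S : {set V}) : nat :=
  rank_bound S [arg min_(B < set0) rank_bound S B].

Lemma rank_le S B : rank S <= rank_bound S B.
Proof. by rewrite /rank; case: arg_minnP => // B0 _; apply. Qed.

Lemma rank_attained S : exists B, rank S = rank_bound S B.
Proof. by eexists. Qed.

Lemma rank_mono (S S' : {set V}) :
  core S \subset core S' -> act S \subset act S' -> rank S <= rank S'.
Proof.
move=> hc ha; have [B ->] := rank_attained S'.
apply: leq_trans (rank_le S B) _; apply: leq_add.
  by apply/subset_leq_card/setSU.
rewrite [leqRHS](big_setID (act S :\: B)) /=.
rewrite (setIidPr _); first exact: leq_addr.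
exact: setSD.
Qed.

(** Uncrossing: the union and the intersection of minimizers for [S] and [S'] bound the ranks of
    [S :|: S'] and [S :&: S']. The weights are compared point by point. *)
Lemma rank_submod (S S' : {set V}) :
  core (S :|: S') = core S :|: core S' -> core (S :&: S') \subset core S :&: core S' ->
  act (S :|: S') = act S :|: act S' -> act (S :&: S') \subset act S :&: act S' ->
  rank (S :|: S') + rank (S :&: S') <= rank S + rank S'.
Proof.
move=> cU cI aU aI.
have [B ->] := rank_attained S; have [B' ->] := rank_attained S'.
apply: leq_trans (leq_add (rank_le _ (B :|: B')) (rank_le _ (B :&: B'))) _.
rewrite /rank_bound cU aU addnACA [leqRHS]addnACA; apply: leq_add.
  rewrite -[leqRHS]cardsUI bigcup_setU setUACA leq_add2l.
  apply: subset_leq_card; rewrite subsetI !subUset.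
  have /andP[c1 c2] : (core (S :&: S') \subset core S) && (core (S :&: S') \subset core S').
    by rewrite -subsetI.
  rewrite (subset_trans c1 (subsetUl _ _)) (subset_trans c2 (subsetUl _ _)) /=.
  by apply/andP; split; apply/bigcupsP => b /setIP[bB bB'];
     apply/subsetU; rewrite (bigcup_sup b) ?orbT.
have wE A C : \sum_(b in A :\: C) w b = \sum_b (b \in A) && (b \notin C) * w b.
  by rewrite big_mkcond; apply: eq_bigr => b _; rewrite inE andbC; case: ifP; rewrite ?mul1n.
rewrite !wE -!big_split /=; apply: leq_sum => b _.
move/subsetP: aI => /(_ b); rewrite !inE.
case: (b \in act S); case: (b \in act S'); case: (b \in act (S :&: S')) => [/(_ isT)|_] //;
by case: (b \in B); case: (b \in B'); rewrite ?addn0 ?leq_addr ?leq_addl.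
Qed.
End Rank.

(** * The instances *)

Lemma cardsUD (T : finType) (A B : {set T}) : #|A :|: B| = #|A| + #|B :\: A|.
Proof. have := cardsUI A B; have := cardsID A B; rewrite setIC; lia. Qed.

Section Instance.
Context {V : finType} (lab : V -> option 'I_3) (t : 'I_3 -> V) (m l : nat).
Implicit Types (S X : {set V}) (i j : 'I_3) (H : {ffun V -> bool}).

(* The elements with label [k] form the cluster shared by the two terminals other
   than [k]; unlabelled elements are the terminals and padding of value 0. *)
Definition star i : {set V} := [set v | (lab v != None) && (lab v != Some i)].

(* The bit [H v] orients an element of cluster [k] towards [k - 1] or [k + 1]
   (indices mod 3), so that the three halves partition the labelled elements. *)
Definition halfstar H i : {set V} :=
  [set v in star i | H v (+) (lab v == Some (i + 1)%R)].

Definition labelled S : {set V} := [set v in S | lab v != None].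

Definition active S : {set bool * 'I_3} := [set b | t b.2 \in S].

(* Terminal [i] is the join of a point [(true, i)] of weight [m - l] in the flat of
   [R i] and a point [(false, i)] of weight [m + l] in the flat of [star i]. *)
Definition reach (R : 'I_3 -> {set V}) (b : bool * 'I_3) : {set V} :=
  if b.1 then R b.2 else star b.2.

Definition weight (b : bool * 'I_3) : nat := if b.1 then m - l else m + l.

Definition trank (R : 'I_3 -> {set V}) S : nat :=
  rank labelled active (reach R) weight S.

(** [J] stands for the terminals whose whole star a cover contains, so that one condition on [H]
    serves all covers at once. *)
Definition balanced H S := forall i (J : {set 'I_3}),
  let X := star i :\: S :\: \bigcup_(j in J) star j in
  #|X :\: halfstar H i| <= #|X :&: halfstar H i| + l.*2.

Lemma halfstar_sub H i : halfstar H i \subset star i.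
Proof. by apply/subsetP => v; rewrite inE => /andP[]. Qed.

Lemma halfstar_disjoint H i j v : i != j -> v \in halfstar H i -> v \notin halfstar H j.
Proof.
rewrite !inE; case: (lab v) => [k|] //=; rewrite -![Some _ == Some _]/(_ == _).
by case: (H v); move: i j k; do 3!case=> [[|[|[|?]]] //= ?].
Qed.

Lemma cover_halfstar H v : lab v != None -> exists i, v \in halfstar H i.
Proof.
case E: (lab v) => [k|] // _.
exists (if H v then k + 1 else k - 1)%R; rewrite !inE E /=.
rewrite -![Some _ == Some _]/(_ == _).
by case: (H v); move: k {E}; case=> [[|[|[|?]]] //= ?].
Qed.

(* A point [(true, i)] of [B] without [(false, i)] can be removed if [halfstar H i]
   has at least [m - l] uncovered elements; otherwise, by balance, [star i] has at
   most [m + l] of them beyond the half, and [(false, i)] can be added. *)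
Lemma trank_step H S B i : balanced H S ->
  exists B', [/\ rank_bound labelled active (reach (halfstar H)) weight S B' <=
                 rank_bound labelled active (reach (halfstar H)) weight S B,
               (true, i) \in B' -> (false, i) \in B' &
               forall j, j != i -> forall b, ((b, j) \in B') = ((b, j) \in B)].
Proof.
move=> bal.
have [iB|iB] := boolP ((true, i) \in B); last by exists B; rewrite (negPf iB).
have [iB'|iB'] := boolP ((false, i) \in B); first by exists B; rewrite iB'.
have neq b c j : j != i -> ((b, j) == (c, i)) = false.
  by move=> ji; apply/eqP => -[_ ij]; rewrite ij eqxx in ji.
pose Y := labelled S :|: \bigcup_(b in B :\ (true, i)) reach (halfstar H) b.
pose W := \sum_(b in active S :\: ((false, i) |: B)) weight b.
have YB : labelled S :|: \bigcup_(b in B) reach (halfstar H) b = Y :|: halfstar H i.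
  by rewrite (big_setD1 _ iB) /= [reach _ _ :|: _]setUC setUA.
(* If [t i] is not in [S], both points at [i] are inactive and dropping [(true, i)] costs
   nothing. *)
have [ti|ti] := boolP (t i \in S); last first.
  exists (B :\ (true, i)); split; last 1 first.
  - by move=> j ji b; rewrite !inE neq.
  - rewrite /rank_bound -/Y YB; apply: leq_add.
      exact/subset_leq_card/subsetUl.
    rewrite (eq_bigl (mem (active S :\: B))) // => -[b j]; rewrite !inE.
    by have [-> /=|ji] := eqVneq j i; [rewrite (negPf ti) !andbF | rewrite neq].
  - by rewrite !inE eqxx.
have WE : \sum_(b in active S :\: B) weight b = (m + l) + W.
  rewrite (big_setD1 (false, i)) /=; last by rewrite !inE iB' ti.
  by rewrite setDDl setUC.
have WE0 : \sum_(b in active S :\: (B :\ (true, i))) weight b = (m - l) + ((m + l) + W).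
  rewrite (big_setD1 (true, i)) /=; last by rewrite !inE eqxx ti.
  by rewrite setDDl setUC setD1K // WE.
pose X := star i :\: S :\: \bigcup_(j in [set j | (false, j) \in B]) star j.
(* [X] avoids the stars of the points [(false, j)] in [B], and the points [(true, j)] with [j != i]
   cover only halves disjoint from that of [i]. *)
have uX : #|X :&: halfstar H i| <= #|halfstar H i :\: Y|.
  apply/subset_leq_card/subsetP => v /setIP[/setDP[/setDP[vi vS] vJ] vh].
  rewrite in_setD vh andbT; apply/negP => /setUP[|/bigcupP[[c j]]].
    by rewrite inE (negPf vS).
  case/setD1P => cj jB; case: c => /= in cj jB *; rewrite /reach /=; last first.
    by move=> vj; case/negP: vJ; apply/bigcupP; exists j => //; rewrite inE.
  by apply/negP; apply: halfstar_disjoint vh; apply: contra cj => /eqP ->.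
have vX : #|star i :\: (Y :|: halfstar H i)| <= #|X :\: halfstar H i|.
  apply/subset_leq_card/subsetP => v /setDP[vi]; rewrite in_setU negb_or => /andP[vY vh].
  rewrite !in_setD vh vi /= andbT; apply/andP; split; apply: contra vY.
    case/bigcupP => j; rewrite inE => jB vj; apply/setUP; right.
    by apply/bigcupP; exists (false, j) => //; rewrite in_setD1 jB.
  by move=> vS; apply/setUP; left; move: vi; rewrite !inE vS => /andP[].
have := bal i [set j | (false, j) \in B]; rewrite -/X => balX.
have [u_le|u_gt] := leqP (m - l) #|halfstar H i :\: Y|.
  exists (B :\ (true, i)); split; last 1 first.
  - by move=> j ji b; rewrite !inE neq.
  - rewrite /rank_bound -/Y YB WE0 WE cardsUD; lia.
  - by rewrite !inE eqxx.
(* Fewer than [m - l] elements of the half are uncovered, so [(false, i)] covers fewer than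
   [(m - l) + l.*2 = m + l] new elements, and saves weight [m + l]. *)
exists ((false, i) |: B); split; last 1 first.
- by move=> j ji b; rewrite !inE neq.
- rewrite /rank_bound big_setU1 //= -/W WE [reach _ _ :|: _]setUC setUA YB.
  rewrite cardsUD /= /reach /=; lia.
- by rewrite !inE eqxx.
Qed.

Lemma rank_bound_mono (R R' : 'I_3 -> {set V}) S B : (forall i, R i \subset R' i) ->
  rank_bound labelled active (reach R) weight S B <=
  rank_bound labelled active (reach R') weight S B.
Proof.
move=> RR'; rewrite leq_add2r; apply/subset_leq_card/setUS.
apply/bigcupsP => b bB; apply: subset_trans (bigcup_sup _ bB).
by rewrite /reach; case: b.1.
Qed.

(** Halves lie in stars, which gives one inequality. For the other, [trank_step] at each terminal
    makes every [(true, i)] in the cover come with [(false, i)], whose flat is already the whole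
    star. *)
Lemma trank_balanced H S : balanced H S -> trank (halfstar H) S = trank star S.
Proof.
move=> bal; apply/eqP; rewrite eqn_leq; apply/andP; split.
  rewrite {2}/trank /rank; set B := [arg min_(_ < _) _].
  exact: leq_trans (rank_le _ _ _ _ _ B) (rank_bound_mono _ _ (halfstar_sub H)).
have [B0 eB0] := rank_attained labelled active (reach (halfstar H)) weight S.
have [B1 [le1 B1_0 E1]] := trank_step B0 0%R bal.
have [B2 [le2 B2_1 E2]] := trank_step B1 1%R bal.
have [B3 [le3 B3_2 E3]] := trank_step B2 2%R bal.
rewrite [trank (halfstar H) S]eB0; apply: leq_trans (leq_trans le3 (leq_trans le2 le1)).
apply: leq_trans (rank_le _ _ _ _ _ B3) _.
rewrite leq_add2r; apply/subset_leq_card/setUS.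
apply/bigcupsP => -[[] j] jB; last exact: (@bigcup_sup _ _ (false, j) _ (reach (halfstar H)) jB).
apply: (@bigcup_sup _ _ (false, j) _ (reach (halfstar H))).
move: jB; have [->|j2] := eqVneq j 2%R; first exact: B3_2.
rewrite !E3 //; have [->|j1] := eqVneq j 1%R; first exact: B2_1.
rewrite !E2 //; have [->|j0] := eqVneq j 0%R; first exact: B1_0.
by move: j0 j1 j2; case: j => [[|[|[|?]]]].
Qed.

End Instance.

(** * Costs of feasible partitions *)

Section Costs.
Context {V : finType} (lab : V -> option 'I_3) (t : 'I_3 -> V) (m l : nat).
Context (t_inj : injective t) (lab_t : forall i, lab (t i) = None).
Context (card_lab : forall k, #|[set v | lab v == Some k]| = m.*2).
Implicit Types (S : {set V}) (i j k : 'I_3) (H : {ffun V -> bool}).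
Implicit Types (R : 'I_3 -> {set V}).

Local Notation trank := (trank lab t m l).
Local Notation star := (star lab).
Local Notation halfstar := (halfstar lab).

Lemma trank_mono R S S' : S \subset S' -> trank R S <= trank R S'.
Proof.
move=> /subsetP SS'; apply: rank_mono; apply/subsetP => v; rewrite !inE.
  by case/andP => /SS' -> ->.
exact: SS'.
Qed.

Lemma trank_submod R S S' :
  trank R (S :|: S') + trank R (S :&: S') <= trank R S + trank R S'.
Proof.
apply: rank_submod.
- by apply/setP => v; rewrite !inE andb_orl.
- by apply/subsetP => v; rewrite !inE andbACA andbb.
- by apply/setP => b; rewrite !inE.
- by apply/subsetP => b; rewrite !inE.
Qed.

Lemma trank0 R : trank R set0 = 0.
Proof.
apply/eqP; rewrite -leqn0; apply: leq_trans (rank_le _ _ _ _ _ set0) _.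
rewrite /rank_bound big_set0 setU0 big1 => [|b].
  by rewrite addn0 leqn0 cards_eq0; apply/eqP/setP => v; rewrite !inE.
by rewrite !inE.
Qed.

Lemma card_labelled : #|labelled lab setT| = 6 * m.
Proof.
have -> : labelled lab setT = \bigcup_k [set v | lab v == Some k].
  apply/setP => v; rewrite !inE /=; apply/idP/bigcupP.
    by case E: (lab v) => [k|] // _; exists k; rewrite // inE E.
  by case=> k _; rewrite inE => /eqP ->.
rewrite -sum1_card partition_disjoint_bigcup /=; last first.
  move=> i j ij; rewrite -setI_eq0; apply/eqP/setP => v; rewrite !inE.
  by apply/negP => /andP[/eqP -> /eqP[] /esym/eqP]; rewrite eq_sym (negPf ij).
by rewrite (eq_bigr (fun=> m.*2)) => [|k _]; rewrite ?sum1_card // sum_nat_const card_ord; lia.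
Qed.

Lemma sum_card_halfstar H : \sum_(i < 3) #|halfstar H i| <= 6 * m.
Proof.
rewrite -card_labelled (eq_bigr (fun i => \sum_(v in halfstar H i) 1)); last first.
  by move=> i _; rewrite sum1_card.
rewrite -partition_disjoint_bigcup /=; last first.
  move=> i j ij; rewrite -setI_eq0; apply/eqP/setP => v; rewrite in_setI in_set0.
  by apply/negP => /andP[vi]; apply/negP; apply: halfstar_disjoint vi.
rewrite sum1_card; apply/subset_leq_card/bigcupsP => i _.
by apply: subset_trans (halfstar_sub lab H i) _; apply/subsetP => v; rewrite !inE => /andP[].
Qed.

(** When terminal [i] receives its own half, the cover [[set (true, i)]] adds no new element and
    only [(false, i)] is paid for, at [m + l]. The halves have at most [6 * m] elements in all. *)
Lemma feasible_halfstar H : exists2 P : parts V 3, feasible t P &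
  \sum_(i < 3) trank (halfstar H) (P i) <= 9 * m + 3 * l.
Proof.
pose own v i := (t i == v) || (v \in halfstar H i).
(* Padding has no owner and goes to terminal 0, where it adds nothing to the rank. *)
pose a v := odflt 0%R [pick i | own v i].
have aP v i : own v i -> own v (a v).
  by rewrite /a; case: pickP => //= /(_ i) -> .
have halfN i j : t j \notin halfstar H i by rewrite !inE lab_t.
have at_ i : a (t i) = i.
  have : own (t i) i by rewrite /own eqxx.
  by move/aP; rewrite /own (negPf (halfN _ _)) orbF => /eqP/t_inj.
exists [ffun i => [set v | a v == i]].
  apply/and3P; split.
  - apply/eqP/setP => v; rewrite !inE; apply/bigcupP; exists (a v) => //.
    by rewrite ffunE inE.
  - apply/forallP => i; apply/forallP => j; apply/implyP => ij.
    rewrite -setI_eq0; apply/eqP/setP => v; rewrite !ffunE !inE.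
    by apply/negP => /andP[/eqP -> ]; rewrite (negPf ij).
  - by apply/forallP => i; rewrite ffunE inE at_.
have le i : trank (halfstar H) [set v | a v == i] <= #|halfstar H i| + (m + l).
  apply: leq_trans (rank_le _ _ _ _ _ [set (true, i)]) _.
  apply: leq_add.
    rewrite big_set1; apply/subset_leq_card; rewrite subUset subxx andbT.
    apply/subsetP => v /setIdP[]; rewrite inE => /eqP avi labv.
    have [j vj] := cover_halfstar H labv.
    have /aP : own v j by rewrite /own vj orbT.
    rewrite avi /own => /orP[/eqP tv|]; first by rewrite -tv lab_t in labv.
    by [].
  rewrite (bigD1 (false, i)) /=; last by rewrite !inE /= at_ eqxx.
  rewrite big1 ?addn0 // => -[b j]; rewrite !inE /= at_ => /andP[/andP[n1 /eqP ji] n2].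
  by rewrite ji in n1 n2; case: b n1 n2; rewrite eqxx.
apply: (@leq_trans (\sum_(i < 3) (#|halfstar H i| + (m + l)))).
  by apply: leq_sum => i _; rewrite ffunE.
rewrite big_split sum_nat_const /= card_ord.
by apply: leq_trans (leq_add (sum_card_halfstar H) (leqnn _)) _; lia.
Qed.

Lemma card_star_setD i S :
  #|star i :\: S| = \sum_(k < 3) (k != i) * #|[set v | lab v == Some k] :\: S|.
Proof.
have -> : star i :\: S = \bigcup_(k < 3) [set v in star i :\: S | lab v == Some k].
  apply/setP => v; apply/idP/bigcupP => [vi|[k _]]; last by case/setIdP.
  case E: (lab v) => [k|]; last by move: vi; rewrite !inE E andbF.
  by exists k; rewrite // !inE E eqxx andbT; move: vi; rewrite !inE E.
rewrite -sum1_card partition_disjoint_bigcup /=; last first.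
  move=> i' j ij; rewrite -setI_eq0; apply/eqP/setP => v; rewrite !inE.
  apply/negP => /andP[/andP[_ /eqP ->] /andP[_ /eqP[] /esym/eqP]].
  by rewrite eq_sym (negPf ij).
apply: eq_bigr => k _; rewrite sum1_card.
have [->|ki] := eqVneq k i.
  apply/eqP; rewrite mul0n cards_eq0; apply/eqP/setP => v; rewrite !inE.
  by case: (lab v == Some i); rewrite ?andbF.
rewrite mul1n; apply: eq_card => v; rewrite !inE andbC.
case: (lab v =P Some k) => [->|]; rewrite ?andbF ?andbT //=.
by rewrite -[Some _ == _]/(k == i) ki andbT.
Qed.

Context (l_le_m : l <= m).

(** A cover containing either point at [i] contains all of [star i]; one containing neither pays
    both weights, [(m - l) + (m + l) = m.*2]. *)
Lemma trank_star_ge (P : parts V 3) i : feasible t P ->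
  #|labelled lab (P i)| + minn m.*2 #|star i :\: P i| <= trank star (P i).
Proof.
case/and3P => _ /forallP disj /forallP tP.
have act : active t (P i) = [set (true, i); (false, i)].
  apply/setP => -[b j]; rewrite !inE /=; have [->|ji] := eqVneq j i.
    by rewrite tP; case: b; rewrite eqxx ?orbT.
  have -> : (t j \in P i) = false.
    have /forallP/(_ i)/implyP/(_ ji) := disj j.
    by rewrite disjoint_subset => /subsetP/(_ _ (tP j)); rewrite inE => /negPf.
  by apply/esym/negP => /orP[/eqP[_ /eqP]|/eqP[_ /eqP]]; rewrite (negPf ji).
have [B eB] := rank_attained (labelled lab) (active t) (reach lab star) (weight m l) (P i).
rewrite [trank star _]eB {eB}.
have [iB|iB] := boolP [exists b, (b, i) \in B].
  case/existsP: iB => b iB.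
  apply: leq_trans (leq_addr _ _); rewrite cardsUD leq_add2l.
  apply: leq_trans (geq_minr _ _) _; apply/subset_leq_card/subsetP => v.
  case/setDP => vi vP; rewrite !inE (negPf vP) /=.
  by apply/bigcupP; exists (b, i) => //; case: b {iB}.
rewrite negb_exists in iB; move/forallP: iB => iB.
have eA : active t (P i) :\: B = [set (true, i); (false, i)].
  rewrite act; apply/setP => b; rewrite !inE andbC.
  by apply: andb_idr => /orP[]/eqP ->; rewrite iB.
rewrite /rank_bound eA big_setU1 ?big_set1 ?inE //= cardsUD /weight /=.
have := geq_minl m.*2 #|star i :\: P i|; lia.
Qed.

(* With [u i] the part of [star i] outside of [P i], [u i + u j >= 2m] for [i != j]
   and the three add up to at least [6m], so the sum of [min(2m, u i)] is at least [4m]. *)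
Lemma cost_star_ge (P : parts V 3) : feasible t P ->
  10 * m <= \sum_(i < 3) trank star (P i).
Proof.
move=> feasP.
apply: (@leq_trans (\sum_(i < 3) (#|labelled lab (P i)| + minn m.*2 #|star i :\: P i|))); last first.
  by apply: leq_sum => i _; exact: trank_star_ge.
rewrite big_split /=.
have [/eqP covP /forallP disj _] := and3P feasP.
have lab_ge : 6 * m <= \sum_(i < 3) #|labelled lab (P i)|.
  rewrite -card_labelled; have -> : labelled lab setT = \bigcup_i labelled lab (P i).
    apply/setP => v; rewrite !inE /=; apply/idP/bigcupP => [labv|[i _]]; last first.
      by rewrite inE => /andP[].
    have : v \in \bigcup_i P i by rewrite covP inE.
    by case/bigcupP => i _ vi; exists i; rewrite ?inE ?vi.
  rewrite !big_ord_recr !big_ord0 /= set0U add0n.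
  by apply: leq_trans (leq_card_setU _ _) _; rewrite leq_add2r leq_card_setU.
have two i j k : i != j ->
    m.*2 <= #|[set v | lab v == Some k] :\: P i| + #|[set v | lab v == Some k] :\: P j|.
  move=> ij; rewrite -(card_lab k); apply: leq_trans (leq_card_setU _ _).
  apply/subset_leq_card/subsetP => v vk; rewrite in_setU !in_setD vk !andbT -negb_and.
  have /forallP/(_ j)/implyP/(_ ij) := disj i.
  by rewrite -setI_eq0 => /eqP/setP/(_ v); rewrite !inE => ->.
move: lab_ge; rewrite !big_ord_recr !big_ord0 /= !card_star_setD.
rewrite !big_ord_recr !big_ord0 /=.
set a0 := widen_ord _ (widen_ord _ _); set a1 := widen_ord _ ord_max; set a2 := ord_max.
have := two a1 a2 a0 isT; have := two a0 a2 a1 isT; have := two a0 a1 a2 isT.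
lia.
Qed.

End Costs.

(** * Random divisions *)

(** With [m = r * l], the first bound leaves room for three clusters and three terminals, and the
    second keeps [l] linear in [n]. *)
Lemma exists_cluster_size (r n : nat) : 0 < r -> 12 * r + 6 <= n ->
  exists l, 6 * (r * l) + 3 <= n /\ n <= 12 * r * l.
Proof.
move=> r0 n_ge; exists ((n - 3) %/ (6 * r)).
have := leq_trunc_div (n - 3) (6 * r).
have : n - 3 < ((n - 3) %/ (6 * r)).+1 * (6 * r) by rewrite ltn_ceil // muln_gt0.
by move: (_ %/ _) => l; split; nia.
Qed.

Lemma exists_labelling (V : finType) (m : nat) : 6 * m + 3 <= #|V| ->
  exists (lab : V -> option 'I_3) (t : 'I_3 -> V),
  [/\ injective t, forall i, lab (t i) = None &
      forall k, #|[set v | lab v == Some k]| = m.*2].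
Proof.
move=> le_V; pose W : finType := ('I_3 + 'I_3 * 'I_m.*2)%type.
have leW : #|W| <= #|V| by rewrite card_sum card_prod !card_ord; lia.
pose g (x : W) : V := enum_val (widen_ord leW (enum_rank x)).
have g_inj : injective g.
  by move=> x y /enum_val_inj /(congr1 val) /= /val_inj/enum_rank_inj.
pose lab v := if [pick x | g x == v] is Some (inr y) then Some y.1 else None.
have labg x : lab (g x) = if x is inr y then Some y.1 else None.
  rewrite /lab; case: pickP => [y /eqP/g_inj -> //|/(_ x)]; by rewrite eqxx.
exists lab, (g \o inl); split=> [i j /g_inj[]//|i|k]; first by rewrite /= labg.
have -> : [set v | lab v == Some k] = [set g (inr (k, c)) | c : 'I_m.*2].
  apply/setP => v; rewrite inE; apply/eqP/imsetP => [|[c _ ->]]; last by rewrite labg.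
  rewrite /lab; case: pickP => // -[//|[j c]] /eqP <- [->]; by exists c.
by rewrite card_imset ?card_ord // => c d /g_inj[].
Qed.

Section Chernoff.
Context {R : realType} {V : finType}.
Local Open Scope ring_scope.

(** By independence of the bits, each element of [X] contributes a factor [a + a^-1] and any other a
    factor 2, whatever the offset [c]. *)
Lemma sum_prod_fair_bits (a : R) (c : V -> bool) (X : {set V}) :
  \sum_(H : {ffun V -> bool}) \prod_(v in X) (if H v (+) c v then a^-1 else a) =
  2 ^+ #|V| * ((a + a^-1) / 2) ^+ #|X|.
Proof.
pose F v b := if v \in X then (if b (+) c v then a^-1 else a) else 1.
transitivity (\sum_(H : {ffun V -> bool}) \prod_v F v (H v)).
  by apply: eq_bigr => H _; rewrite big_mkcond.
rewrite -bigA_distr_bigA /=.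
have FE v : \sum_b F v b = 2 * (if v \in X then (a + a^-1) / 2 else 1).
  rewrite big_bool /F; case: (v \in X); case: (c v) => /=; lra.
by rewrite (eq_bigr _ (fun v _ => FE v)) big_split /= prodr_const -big_mkcond prodr_const.
Qed.

(** The product is [a] raised to the signed imbalance of [X]. *)
Lemma prod_biased_bits (a : R) (c : V -> bool) (X : {set V}) (H : {ffun V -> bool}) :
  a != 0 ->
  \prod_(v in X) (if H v (+) c v then a^-1 else a) =
  a ^+ #|X :\: [set v | H v (+) c v]| / a ^+ #|X :&: [set v | H v (+) c v]|.
Proof.
move=> a0; rewrite (big_setID [set v | H v (+) c v]) /= mulrC; congr (_ * _).
  rewrite -prodr_const; apply: eq_bigr => v; rewrite !inE => /andP[+ _].
  by case: (_ (+) _).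
rewrite -exprVn -prodr_const; apply: eq_bigr => v; rewrite !inE => /andP[_].
by case: (_ (+) _).
Qed.

(* Markov's inequality for the exponential moment [sum_prod_fair_bits]. *)
Lemma card_unbalanced (a : R) (c : V -> bool) (X : {set V}) (d : nat) : 1 <= a ->
  #|[set H : {ffun V -> bool} |
     ~~ (#|X :\: [set v | H v (+) c v]| <= #|X :&: [set v | H v (+) c v]| + d)%N]|%:R
  <= 2 ^+ #|V| * ((a + a^-1) / 2) ^+ #|X| / a ^+ d.
Proof.
move=> a1; have a0 : 0 < a by lra.
rewrite ler_pdivlMr ?exprn_gt0 // -(sum_prod_fair_bits a c) mulrC -sum1_card natr_sum mulr_sumr.
rewrite big_mkcond /=; apply: ler_sum => H _; rewrite prod_biased_bits ?gt_eqF // inE.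
case: leqP => /= hd; first by rewrite divr_ge0 // exprn_ge0 // ltW.
rewrite mulr1 ler_pdivlMr ?exprn_gt0 // -exprD.
by apply: ler_weXn2l => //; lia.
Qed.

End Chernoff.

Lemma setD_eq_in (T : finType) (X A B : {set T}) : {in X, A =i B} -> X :\: A = X :\: B.
Proof.
by move=> AB; apply/setP => v; rewrite !inE andbC [RHS]andbC; apply: andb_id2l => /AB ->.
Qed.

Lemma setI_eq_in (T : finType) (X A B : {set T}) : {in X, A =i B} -> X :&: A = X :&: B.
Proof. by move=> AB; apply/setP => v; rewrite !inE; apply: andb_id2l => /AB ->. Qed.

Section Indistinguishable.
Context {R : realType}.
Local Open Scope ring_scope.

(** An upper Bernoulli bound, multiplied out so that [1 - N%:R * y] may have any sign. *)
Lemma exprD1_mul_le (y : R) (N : nat) : 0 <= y -> (1 + y) ^+ N * (1 - N%:R * y) <= 1.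
Proof.
move=> y0; elim: N => [|N IH]; first by rewrite mul0r subr0 mulr1.
apply: le_trans IH; rewrite exprSr -mulrA ler_wpM2l ?exprn_ge0 ?addr_ge0 //.
rewrite -natr1; have : 0 <= N%:R :> R by []. nra.
Qed.

(** For [a = 1 + x] the base is at most [1 + x ^+ 2 / 2]. As [N * x = 1], its [N]-th power is at
    most [(1 - x / 2)^-1], which is at most [1 + x] for [x <= 1]. *)
Lemma moment_le (r : nat) (a : R) : (0 < r)%N -> a = 1 + (6 * r)%:R^-1 ->
  ((a + a^-1) / 2) ^+ (6 * r) <= a.
Proof.
move=> r0 ->; set N := (6 * r)%N; set x : R := N%:R^-1.
have N0 : 0 < N%:R :> R by rewrite ltr0n /N; lia.
have x0 : 0 < x by rewrite invr_gt0.
have x1 : x <= 1 by rewrite invf_le1 // ler1n /N; lia.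
have Nx : N%:R * x = 1 by rewrite divff // gt_eqF.
have b_le : (1 + x + (1 + x)^-1) / 2 <= 1 + x ^+ 2 / 2.
  have : (1 + x)^-1 <= 1 - x + x ^+ 2.
    rewrite -[X in X <= _]div1r ler_pdivrMr; last by lra.
    have -> : (1 - x + x ^+ 2) * (1 + x) = 1 + x ^+ 3 by ring.
    by rewrite lerDl exprn_ge0 // ltW.
  lra.
have b0 : 0 <= (1 + x + (1 + x)^-1) / 2.
  by rewrite divr_ge0 ?addr_ge0 ?invr_ge0 // ?addr_ge0 // ltW.
apply: le_trans (_ : (1 + x ^+ 2 / 2) ^+ N <= _); first by apply: lerXn2r; rewrite ?nnegrE // (le_trans b0).
have y0 : 0 <= x ^+ 2 / 2 by rewrite divr_ge0 ?sqr_ge0.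
have := exprD1_mul_le N y0.
have -> : N%:R * (x ^+ 2 / 2) = x / 2 by rewrite expr2 !mulrA Nx mul1r.
have : 0 <= (1 + x ^+ 2 / 2) ^+ N by rewrite exprn_ge0 ?addr_ge0.
move: (_ ^+ N) => z z0; nra.
Qed.

Context {V : finType} (lab : V -> option 'I_3) (t : 'I_3 -> V) (r l : nat).
Local Notation m := (r * l)%N.
Context (r_gt0 : (0 < r)%N).
Context (card_lab : forall k, #|[set v | lab v == Some k]| = m.*2).

(** A union bound over the 24 pairs [(i, J)], one of which must be unbalanced. At most [6 * r * l]
    elements are involved, so the moment is at most [a ^+ l], against a threshold [a ^+ l.*2]. *)
Lemma card_distinguished (S : {set V}) (a : R) : a = 1 + (6 * r)%:R^-1 ->
  #|[set H : {ffun V -> bool} |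
     trank lab t m l (halfstar lab H) S != trank lab t m l (star lab) S]|%:R
  <= 24 * 2 ^+ #|V| / a ^+ l.
Proof.
move=> ea.
have a1 : 1 <= a by rewrite ea lerDl invr_ge0.
have a0 : 0 < a by lra.
pose X (p : 'I_3 * {set 'I_3}) := star lab p.1 :\: S :\: \bigcup_(j in p.2) star lab j.
pose D (p : 'I_3 * {set 'I_3}) := [set H : {ffun V -> bool} |
  ~~ (#|X p :\: halfstar lab H p.1| <= #|X p :&: halfstar lab H p.1| + l.*2)%N].
have DU : [set H : {ffun V -> bool} |
     trank lab t m l (halfstar lab H) S != trank lab t m l (star lab) S]
   \subset \bigcup_p D p.
  apply/subsetP => H; rewrite inE; apply: contraR => HD.
  apply/eqP/trank_balanced => i J; apply: contraR HD => HD.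
  by apply/bigcupP; exists (i, J); rewrite ?inE.
have Dp p : #|D p|%:R <= 2 ^+ #|V| / a ^+ l.
  have -> : D p = [set H : {ffun V -> bool} |
     ~~ (#|X p :\: [set v | H v (+) (lab v == Some (p.1 + 1)%R)]| <=
         #|X p :&: [set v | H v (+) (lab v == Some (p.1 + 1)%R)]| + l.*2)%N].
    apply/setP => H; rewrite !inE.
    have E : {in X p, halfstar lab H p.1 =i
                      [set v | H v (+) (lab v == Some (p.1 + 1)%R)]}.
      by move=> v /setDP[/setDP[+ _] _]; rewrite !inE => ->.
    by rewrite (setD_eq_in E) (setI_eq_in E).
  apply: le_trans (card_unbalanced _ _ _ a1) _.
  rewrite -mulrA ler_wpM2l ?exprn_ge0 //.
  rewrite ler_pdivrMr ?exprn_gt0 // -addnn exprD mulrA mulVf ?expf_neq0 ?gt_eqF // mul1r.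
  apply: le_trans (_ : ((a + a^-1) / 2) ^+ (6 * m) <= _).
    (* The base is at least 1, so the exponent may be raised from the size of [X] to [6 * m]. *)
    apply: ler_weXn2l.
      rewrite ler_pdivlMr // -subr_ge0.
      have -> : a + a^-1 - 1 * 2 = (a - 1) ^+ 2 / a by field; rewrite gt_eqF.
      by rewrite divr_ge0 ?sqr_ge0 // ltW.
    rewrite -(card_labelled card_lab); apply/subset_leq_card/subsetP => v.
    by rewrite !inE => /and3P[_ _ /andP[]].
  rewrite mulnA exprM; apply: lerXn2r; rewrite ?nnegrE ?exprn_ge0 ?(ltW a0) //.
    by apply: divr_ge0 => //; apply: addr_ge0; rewrite ?invr_ge0 ltW.
  exact: moment_le.
apply: le_trans (_ : \sum_p #|D p|%:R <= _).
  rewrite -natr_sum ler_nat; apply: leq_trans (subset_leq_card DU) _.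
  elim/big_ind2: _ => [|A n B n' hA hB|//]; first by rewrite cards0.
  by apply: leq_trans (leq_card_setU _ _) _; apply: leq_add.
apply: le_trans (ler_sum _ (fun p _ => Dp p)) _.
by rewrite sumr_const card_prod -[X in (_ * X)%N]cardsT -powersetT card_powerset cardsT !card_ord -[leLHS]mulr_natl mulrA.
Qed.

End Indistinguishable.

(** * Adaptive queries against a family of hidden functions *)

Section HiddenFamily.
Local Open Scope ring_scope.
Context {R : realType} {V : finType} (k : nat) (I : finType).
Context (f : I -> {set V} -> R) (g : {set V} -> R) (B : R).
Context (card_neq : forall S, #|[set h | f h S != g S]|%:R <= B).

(** The costs must coincide too, so that a lower bound on the cost under [g] transfers to [f h]. *)
Definition agree (h : I) (q : query_tree R V k) : bool :=
  (answer (f h) q == answer g q) && (cost (f h) (answer g q) == cost g (answer g q)).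

(** Along the run on [g], each queried set and each of the [k] parts returned distinguishes at most
    [B] of the indices. *)
Lemma card_disagree (q : query_tree R V k) :
  #|[set h | ~~ agree h q]|%:R <= (nqueries g q + k)%:R * B.
Proof.
elim: q => [P|S next IH].
  rewrite add0n; apply: (@le_trans _ _ (\sum_(i < k) #|[set h | f h (P i) != g (P i)]|%:R)).
    rewrite -natr_sum ler_nat.
    apply: (@leq_trans #|(\bigcup_(i < k) [set h | f h (P i) != g (P i)])|).
      apply/subset_leq_card/subsetP => h; rewrite inE; apply: contraR => hP.
      rewrite /agree eqxx /=; apply/eqP/eq_bigr => i _; apply/eqP; apply: contraR hP => hP.
      by apply/bigcupP; exists i; rewrite // inE.
    elim/big_ind2: _ => [|A n B' n' hA hB|//]; first by rewrite cards0.
    by apply: leq_trans (leq_card_setU _ _) _; apply: leq_add.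
  by apply: le_trans (ler_sum _ (fun i _ => card_neq _)) _; rewrite sumr_const card_ord mulr_natl.
rewrite [nqueries _ _]/= addSn -natr1 mulrDl mul1r addrC.
apply: le_trans (lerD (card_neq S) (IH (g S))); rewrite -natrD ler_nat.
apply: leq_trans (leq_card_setU _ _); apply/subset_leq_card/subsetP => h.
by rewrite !inE /agree /=; have [->|] := eqVneq (f h S) (g S).
Qed.

End HiddenFamily.

From mathcomp Require Import all_classical all_reals all_analysis.
From mathcomp Require Import measurable_realfun.

Local Open Scope ring_scope.

(** * Randomized algorithms *)

Section Averaging.
Context {R : realType} (A : algorithm R) {V : finType} (k : nat) (t : 'I_k -> V).
Local Open Scope classical_set_scope.

(** There are finitely many pairs of answers, so any predicate [Q] gives a finite union of
    measurable events. *)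
Lemma measurable_answers (f g : {set V} -> R) (Q : parts V k -> parts V k -> Prop) :
  mono_sub_mp t f -> mono_sub_mp t g ->
  measurable [set w : seed A | Q (answer f (tree t w)) (answer g (tree t w))].
Proof.
move=> mf mg.
have -> : [set w : seed A | Q (answer f (tree t w)) (answer g (tree t w))] =
  \big[setU/set0]_(p : parts V k * parts V k | `[< Q p.1 p.2 >])
     ([set w : seed A | answer f (tree t w) = p.1] `&` [set w | answer g (tree t w) = p.2]).
  apply/seteqP; split => [w Qw|w].
    rewrite -bigcup_seq_cond /=.
    exists (answer f (tree t w), answer g (tree t w)) => //=.
    by rewrite mem_index_enum /=; apply/asboolP.
  by rewrite -bigcup_seq_cond => -[p /= /andP[_ /asboolP Qp] [-> ->]].
apply: bigsetU_measurable => p _; apply: measurableI; exact: measurable_answer.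
Qed.

Lemma measurable_fun_answer (f : {set V} -> R) (phi : parts V k -> R) :
  mono_sub_mp t f ->
  measurable_fun [set: seed A] (fun w : seed A => phi (answer f (tree t w))).
Proof.
move=> mf _ Y _; rewrite setTI.
exact: (measurable_answers (fun P _ => Y (phi P)) mf mf).
Qed.

Lemma measurable_fun_nqueries (f : {set V} -> R) : mono_sub_mp t f ->
  measurable_fun [set: seed A] (fun w : seed A => (nqueries f (tree t w))%:R : R).
Proof.
move=> mf _ Y _; rewrite setTI.
have -> : (fun w : seed A => (nqueries f (tree t w))%:R : R) @^-1` Y =
  \bigcup_(m in [set m : nat | Y m%:R]) [set w : seed A | nqueries f (tree t w) = m].
  apply/seteqP; split => [w Yw|w [m Ym /= ->]] //.
  by exists (nqueries f (tree t w)).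
by apply: bigcup_measurable => m _; exact: measurable_nqueries.
Qed.

Context (I : finType) (f : I -> {set V} -> R) (g : {set V} -> R) (B : R).
Context (f_inst : forall h, mono_sub_mp t (f h)) (g_inst : mono_sub_mp t g).

Definition disagreement (h : I) : set (seed A) :=
  [set w | ~~ agree f g h (tree t w)].

Lemma measurable_disagreement h : measurable (disagreement h).
Proof.
exact: (measurable_answers
  (fun P P' => ~~ ((P == P') && (cost (f h) P' == cost g P'))) (f_inst h) g_inst).
Qed.

(** The bound [card_disagree] holds for every seed and is integrated; the finite sum over [h]
    commutes with the integral. *)
Lemma sum_disagreement : 0 <= B ->
  (forall S, #|[set h | f h S != g S]%SET|%:R <= B) ->
  (\sum_h seed_law A (disagreement h) <= B%:E * (expected_queries A t g + k%:R%:E))%E.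
Proof.
move=> B0 card_neq.
have mD h : measurable_fun [set: seed A] (EFin \o (\1_(disagreement h) : seed A -> R)).
  by apply/measurable_EFinP; apply: measurable_indic; exact: measurable_disagreement.
have mq : measurable_fun [set: seed A] (EFin \o (fun w : seed A => (nqueries g (tree t w))%:R : R)).
  by apply/measurable_EFinP; exact: measurable_fun_nqueries.
rewrite (eq_bigr (fun h => \int[seed_law A]_w (\1_(disagreement h) w)%:E)%E); last first.
  by move=> h _; rewrite integral_indic ?setIT //; exact: measurable_disagreement.
rewrite -ge0_integral_sum //.
have -> : (expected_queries A t g + k%:R%:E =
    \int[seed_law A]_w ((nqueries g (tree t w))%:R%:E + k%:R%:E))%E.
  rewrite (ge0_integralD _ _ _ mq) //; last by move=> *; rewrite lee_fin.
  by rewrite -[in LHS](expectation_cst (seed_law A)) /expected_queries unlock.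
rewrite -ge0_integralZl //; last 2 first.
  by apply: emeasurable_funD.
  by move=> w _; rewrite adde_ge0 // lee_fin.
apply: ge0_le_integral => //.
- by move=> w _; apply: sume_ge0 => h _; rewrite lee_fin.
- exact: emeasurable_sum.
- by apply: measurable_funeM; apply: emeasurable_funD.
move=> w _; rewrite sumEFin -EFinD -EFinM lee_fin.
apply: le_trans (le_trans (card_disagree card_neq (tree t w)) _); last first.
  by rewrite natrD mulrC.
rewrite -sum1_card natr_sum [leRHS]big_mkcond /=; apply: ler_sum => h _.
rewrite indicE finset.in_set; have [/set_mem/= -> //|_] := boolP (w \in disagreement h).
by case: ifP.
Qed.

End Averaging.

Section Opt.
Context {R : realType} {V : finType} (k : nat) (t : 'I_k -> V) (f : {set V} -> R).
Context (f_ge0 : nonnegative f).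

Lemma cost_ge0 (P : parts V k) : 0 <= cost f P.
Proof. by apply: sumr_ge0 => i _; exact: f_ge0. Qed.

Lemma opt_le (P : parts V k) : feasible t P -> opt t f <= cost f P.
Proof.
move=> feasP; apply: ge_inf; last by exists P.
by exists 0 => _ [Q _ <-]; exact: cost_ge0.
Qed.

Lemma opt_ge0 : 0 <= opt t f.
Proof.
rewrite /opt; have [->|/set0P ne] := eqVneq [set cost f P | P in [set` feasible t]]%classic set0.
  by rewrite inf0.
by apply: lb_le_inf => // _ [Q _ <-]; exact: cost_ge0.
Qed.

End Opt.

Section DisagreementLowerBound.
Context {R : realType} (A : algorithm R) {V : finType} (k : nat) (t : 'I_k -> V).
Context (I : finType) (f : I -> {set V} -> R) (g : {set V} -> R) (beta L : R) (h : I).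
Context (f_inst : forall h, mono_sub_mp t (f h)) (g_inst : mono_sub_mp t g).
Context (g_cost : forall P : parts V k, feasible t P -> L <= cost g P).
Local Open Scope classical_set_scope.

Lemma agree_cost_ge (w : seed A) : agree f g h (tree t w) ->
  feasible t (output t (f h) w) -> L <= cost (f h) (output t (f h) w).
Proof.
rewrite /agree /output => /andP[/eqP -> /eqP ->]; exact: g_cost.
Qed.

(** A feasible answer on an agreeing run costs at least [L], so success forces disagreement. *)
Lemma disagreement_ge_success : beta * opt t (f h) < L ->
  (seed_law A (success (A := A) beta t (f h)) <= seed_law A (disagreement t f g h))%E.
Proof.
move=> ltL; apply: le_measure; rewrite ?inE.
- exact: (measurable_answers A (fun P _ => feasible t P /\ cost (f h) P <= beta * opt t (f h))
            (f_inst h) (f_inst h)).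
- exact: measurable_disagreement.
move=> w [feasw costw]; apply/negP => agw.
have := agree_cost_ge agw feasw; lra.
Qed.

Lemma disagreement_ge_expectation : 0 <= L ->
  {ae seed_law A, forall w, feasible t (output t (f h) w)} ->
  ('E_(seed_law A)[fun w => cost (f h) (output t (f h) w)] <= (beta * opt t (f h))%:E)%E ->
  (L%:E <= (beta * opt t (f h))%:E + L%:E * seed_law A (disagreement t f g h))%E.
Proof.
move=> L0 feas_ae Ecost; set D : set (seed A) := disagreement t f g h.
have mD : measurable D by exact: measurable_disagreement.
(* Adding the indicator of this null event makes the bound [L <= cost + L * 1_D + L * 1_F] hold at
   every seed. *)
pose F := [set w : seed A | ~ feasible t (output t (f h) w)].
have mF : measurable F.
  exact: (measurable_answers A (fun P _ => ~ feasible t P) (f_inst h) (f_inst h)).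
have F0 : seed_law A F = 0%E by apply/negligibleP.
have cost_pos (w : seed A) : 0 <= cost (f h) (output t (f h) w).
  by apply: cost_ge0; case: (f_inst h).
have mcost : measurable_fun [set: seed A] (EFin \o (fun w => cost (f h) (output t (f h) w))).
  by apply/measurable_EFinP; exact: measurable_fun_answer.
have mL (E : set (seed A)) : measurable E ->
    measurable_fun [set: seed A] (fun w => L%:E * (\1_E w)%:E)%E.
  by move=> mE; apply: measurable_funeM; apply/measurable_EFinP; apply: measurable_indic.
have intL (E : set (seed A)) : measurable E ->
    (\int[seed_law A]_w (L%:E * (\1_E w)%:E) = L%:E * seed_law A E)%E.
  move=> mE; rewrite ge0_integralZl ?integral_indic ?setIT //.
  by apply/measurable_EFinP; apply: measurable_indic.
have pos (E : set (seed A)) w : (0%R <= L%:E * (\1_E w)%:E)%E by rewrite mule_ge0 ?lee_fin.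
have : (\int[seed_law A]_w (cst L%:E w) <= \int[seed_law A]_w
   ((cost (f h) (output t (f h) w))%:E + (L%:E * (\1_D w)%:E + L%:E * (\1_F w)%:E)))%E.
  apply: ge0_le_integral => //.
    by apply: emeasurable_funD => //; apply: emeasurable_funD; exact: mL.
  move=> w _; rewrite /= -!EFinM -!EFinD lee_fin !indicE.
  have [_|] := boolP (w \in D); first by have := cost_pos w; case: (w \in F); rewrite /= ?mulr0 mulr1; lra.
  rewrite notin_setE => /negP; rewrite negbK => agw.
  have [_|] := boolP (w \in F); first by have := cost_pos w; rewrite /= mulr0 mulr1; lra.
  rewrite notin_setE => /contrapT feasw; by have := agree_cost_ge agw feasw; rewrite /= !mulr0 !addr0.
have -> : (\int[seed_law A]_w cst L%:E w = L%:E)%E.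
  by have := expectation_cst (seed_law A) L; rewrite unlock.
move=> /le_trans; apply.
rewrite ge0_integralD //; last 3 first.
- by move=> w _; rewrite lee_fin.
- by move=> w _; rewrite adde_ge0.
- by apply: emeasurable_funD; exact: mL.
rewrite ge0_integralD //; try exact: mL.
by rewrite !intL // F0 mule0 adde0; apply: leeD => //; move: Ecost; rewrite unlock.
Qed.

End DisagreementLowerBound.

Lemma mono_sub_mp_trank (R : realType) (V : finType) (lab : V -> option 'I_3)
  (t : 'I_3 -> V) (m l : nat) (N : 'I_3 -> {set V}) :
  injective t -> mono_sub_mp t (fun S => (trank lab t m l N S)%:R : R).
Proof.
move=> t_inj; split => //; first by rewrite /normalized trank0.
split => [S S' SS'|S S']; first by rewrite ler_nat; exact: trank_mono.
by rewrite -!natrD ler_nat; exact: trank_submod.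
Qed.

(** * The cost gap and the resulting query bound *)

Section Gap.
Context {R : realType} (V : finType) (lab : V -> option 'I_3) (t : 'I_3 -> V).
Context (r l : nat) (eps e : R).
Local Notation m := (r * l)%N.
Context (t_inj : injective t) (lab_t : forall i, lab (t i) = None).
Context (card_lab : forall k, #|[set v | lab v == Some k]%SET| = m.*2).
Context (e_gt0 : 0 < e) (e_le1 : e <= 1) (e_le : e <= eps) (er_gt1 : 1 < e * r%:R).
Context (l_gt0 : (0 < l)%N).

Definition visible (S : {set V}) : R := (trank lab t m l (star lab) S)%:R.

Definition hidden (H : {ffun V -> bool}) (S : {set V}) : R :=
  (trank lab t m l (halfstar lab H) S)%:R.

Lemma r_gt0 : (0 < r)%N.
Proof. by case: r er_gt1 => //; rewrite mulr0 ltr10. Qed.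

Lemma visible_cost (P : parts V 3) : feasible t P -> 10 * (r%:R * l%:R) <= cost visible P.
Proof.
move=> feasP; rewrite /cost /visible -natr_sum -!natrM ler_nat.
by apply: cost_star_ge feasP => //; rewrite leq_pmull ?r_gt0.
Qed.

(** Passing from [eps] to [e <= 1] keeps the factor positive, so the upper bound on [opt] can be
    multiplied by it. *)
Lemma hidden_opt H :
  (10 / 9 - eps) * opt t (hidden H) <= (10 / 9 - e) * (9 * r%:R + 3) * l%:R.
Proof.
have H0 : nonnegative (hidden H) by move=> S; rewrite ler0n.
have [P feasP costP] := feasible_halfstar l t_inj lab_t card_lab H.
have o0 := opt_ge0 t H0; have := opt_le H0 feasP.
have : cost (hidden H) P <= (9 * r%:R + 3) * l%:R.
  by rewrite /cost /hidden -natr_sum -!natrM -natrD -natrM ler_nat mulnDl -mulnA.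
move=> h1 h2; have {h1 h2} := le_trans h2 h1.
rewrite -mulrA; move: o0; set o := opt _ _; set u := (_ * l%:R) => o0 ou.
apply: (@le_trans _ _ ((10 / 9 - e) * o)); first by apply: ler_wpM2r => //; rewrite lerD2l lerN2.
by apply: ler_wpM2l => //; have := e_le1; lra.
Qed.

(** The slack proportional to [e / 2] is what the expectation case consumes; [1 < e * r%:R] absorbs
    the excess [3 * l] in the hidden cost. *)
Lemma hidden_opt_gap H : (10 / 9 - eps) * opt t (hidden H) + 10 * (r%:R * l%:R) * (e / 2) <
  10 * (r%:R * l%:R).
Proof.
apply: le_lt_trans (lerD (hidden_opt H) (lexx _)) _.
have -> : (10 / 9 - e) * (9 * r%:R + 3) * l%:R + 10 * (r%:R * l%:R) * (e / 2) =
  10 * (r%:R * l%:R) - (4 * (e * r%:R) + 3 * e - 10 / 3) * l%:R :> R by field.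
rewrite ltrBlDr ltrDl mulr_gt0 ?ltr0n //; have := e_gt0; have := er_gt1; lra.
Qed.

Lemma disagreement_ge (p : R) (A : algorithm R) H :
  approx_with_probability p (10 / 9 - eps) A \/
    approx_in_expectation (10 / 9 - eps) A ->
  ((Num.min p (e / 2))%:E <= seed_law A (disagreement t hidden visible H))%E.
Proof.
have hi H' : mono_sub_mp t (hidden H') by exact: mono_sub_mp_trank.
have vi : mono_sub_mp t visible by exact: mono_sub_mp_trank.
have L0 : 0 < 10 * (r%:R * l%:R) :> R by rewrite !mulr_gt0 ?ltr0n ?r_gt0.
have := hidden_opt_gap H; set L := 10 * _ in L0 * => gapH.
case=> [/(_ _ _ _ _ (hi H)) hp|/(_ _ _ _ _ (hi H)) [feas_ae Ecost]].
  apply: (@le_trans _ _ p%:E); first by rewrite lee_fin ge_min lexx.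
  apply: le_trans hp _; apply: (disagreement_ge_success A hi vi visible_cost).
  apply: le_lt_trans gapH; rewrite lerDl mulr_ge0 ?divr_ge0 // ltW //.
apply: (@le_trans _ _ (e / 2)%:E); first by rewrite lee_fin ge_min lexx orbT.
have := disagreement_ge_expectation hi vi visible_cost (ltW L0) feas_ae Ecost.
move=> hL; rewrite leNgt; apply/negP => hD; move: hL; apply/negP; rewrite -ltNge.
apply: le_lt_trans (_ : _ <= ((10 / 9 - eps) * opt t (hidden H) + L * (e / 2))%:E)%E _.
  rewrite EFinD (EFinM L); apply: leeD2l; apply: lee_wpmul2l; last exact: ltW.
  by rewrite lee_fin ltW.
by rewrite lte_fin.
Qed.

(** Double counting over all [H]: each disagrees with probability at least [d], while fewer than [q]
    expected queries allow an average of at most [24 * (q + 3) / a ^+ l]. *)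
Lemma expected_queries_ge (p : R) (A : algorithm R) (a : R) (q : R) : 
  approx_with_probability p (10 / 9 - eps) A \/
    approx_in_expectation (10 / 9 - eps) A ->
  a = 1 + (6 * r)%:R^-1 -> q ^+ 2 <= a ^+ l -> 1 < q -> 96 <= Num.min p (e / 2) * q ->
  (q%:E <= expected_queries A t visible)%E.
Proof.
move=> apx ea qa q1 qd; rewrite leNgt; apply/negP => ltq.
set d := Num.min p (e / 2) in qd.
have a0 : 0 < a by rewrite ea ltr_pwDl // invr_ge0.
have al0 : 0 < a ^+ l by rewrite exprn_gt0.
have N0 : 0 < 2 ^+ #|V| :> R by rewrite exprn_gt0.
have B0 : 0 <= 24 * 2 ^+ #|V| / a ^+ l by rewrite divr_ge0 ?mulr_ge0 // ltW.
have hi H' : mono_sub_mp t (hidden H') by exact: mono_sub_mp_trank.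
have vi : mono_sub_mp t visible by exact: mono_sub_mp_trank.
have := sum_disagreement A hi vi B0.
have card S : #|[set H | hidden H S != visible S]%SET|%:R <= 24 * 2 ^+ #|V| / a ^+ l.
  apply: le_trans (card_distinguished t r_gt0 card_lab S ea).
  by rewrite ler_nat; apply/eq_leq/eq_card => H; rewrite !finset.in_set eqr_nat.
move/(_ card) => hsum.
have : ((2 ^+ #|V| * d)%:E <= (24 * 2 ^+ #|V| / a ^+ l * (q + 3))%:E)%E.
  apply: (@le_trans _ _ (\sum_(H : {ffun V -> bool}) seed_law A (disagreement t hidden visible H))%E).
    apply: (@le_trans _ _ (\sum_(H : {ffun V -> bool}) d%:E)%E); last first.
      by apply: lee_sum => H _; exact: disagreement_ge.
    by rewrite sumEFin sumr_const card_ffun card_bool -[X in (_ <= X%:E)%E]mulr_natl natrX.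
  apply: le_trans hsum _; rewrite [leRHS]EFinM; apply: lee_wpmul2l; first by rewrite lee_fin.
  by rewrite (EFinD q); apply: leeD => //; exact: ltW.
rewrite lee_fin; have -> : 24 * 2 ^+ #|V| / a ^+ l * (q + 3) = 2 ^+ #|V| * (24 * (q + 3) / a ^+ l).
  by field; rewrite gt_eqF.
rewrite (ler_pM2l N0) ler_pdivlMr //.
have d0 : 0 < d by rewrite -(pmulr_lgt0 _ (lt_trans ltr01 q1)); lra.
(* Since [1 < q], [24 * (q + 3) < 96 * q <= d * q ^+ 2 <= d * a ^+ l], a contradiction. *)
have := ler_wpM2l (ltW d0) qa; nra.
Qed.
End Gap.

Theorem theorem1p2 (R : realType) (eps : R) (eps_gt0 : 0 < eps)
    (p : R) (p_gt0 : 0 < p) :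
  exists c : R, 0 < c /\ exists n0 : nat,
  forall A : algorithm R,
    approx_with_probability p (10%:R / 9%:R - eps) A \/
    approx_in_expectation (10%:R / 9%:R - eps) A ->
  forall (n : nat) (V : finType), (n0 <= n)%N -> #|V| = n ->
  exists (k : nat) (t : 'I_k -> V) (f : {set V} -> R),
    mono_sub_mp t f /\
    ((2%:R `^ (c * n%:R))%:E <= expected_queries A t f)%E.
Proof.
pose e := Num.min eps 1.
have e_gt0 : 0 < e by rewrite lt_min eps_gt0 ltr01.
have e_le1 : e <= 1 by rewrite ge_min lexx orbT.
have e_le : e <= eps by rewrite ge_min lexx.
pose r := (Num.truncn e^-1).+1.
have er_gt1 : 1 < e * r%:R.
  by rewrite mulrC -ltr_pdivrMr // div1r truncnS_gt.
have r_gt0' : 0 < r%:R :> R by rewrite ltr0n.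
pose d := Num.min p (e / 2).
have d_gt0 : 0 < d by rewrite lt_min p_gt0 divr_gt0.
pose a : R := 1 + (6 * r)%:R^-1.
have a_gt1 : 1 < a by rewrite ltrDl invr_gt0 ltr0n.
have lna : 0 < ln a by rewrite ln_gt0.
have ln2 : 0 < ln 2 :> R by rewrite ln_gt0 // ltr1n.
(* This makes the bound [expR (s * n%:R)], whose square is at most [a ^+ l] because
   [n <= 12 * r * l]. *)
exists (ln a / (24 * r%:R * ln 2)); split; first by rewrite divr_gt0 ?mulr_gt0.
pose s := ln a / (24 * r%:R).
have s_gt0 : 0 < s by rewrite divr_gt0 ?mulr_gt0.
(* The first summands serve [exists_cluster_size]; the last gives [96 / d < s * n%:R], hence
   [96 <= d * expR (s * n%:R)]. *)
exists (12 * r + 6 + (Num.truncn (96 / d / s)).+1)%N => A apx n V n0n cardV.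
have n_ge : (12 * r + 6 <= n)%N by apply: leq_trans n0n; exact: leq_addr.
have [l [ln_n n_le]] := exists_cluster_size (ltn0Sn _ : 0 < r)%N n_ge.
have l_gt0 : (0 < l)%N.
  by rewrite lt0n; apply: contraTneq n_le => ->; rewrite muln0 -ltnNge (leq_trans _ n_ge) ?addnS.
have [|lab [t [t_inj lab_t card_lab]]] := @exists_labelling V (r * l); first by rewrite cardV.
exists 3, t, (visible lab t r l); split; first exact: mono_sub_mp_trank.
have -> : 2 `^ (ln a / (24 * r%:R * ln 2) * n%:R) = expR (s * n%:R) :> R.
  rewrite /powR pnatr_eq0 /=; congr expR; rewrite /s; field.
  by rewrite !gt_eqF.
have n_gt0 : 0 < n%:R :> R by rewrite ltr0n (leq_trans _ n_ge) ?addnS.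
apply: (expected_queries_ge t_inj lab_t card_lab e_gt0 e_le1 e_le er_gt1 l_gt0 apx (erefl a)).
- rewrite -expRM_natl -[a in leRHS]lnK ?posrE ?(lt_trans ltr01) // -expRM_natl ler_expR.
  have -> : 2%:R * (s * n%:R) = n%:R * (ln a / (12 * r%:R)) by rewrite /s; field; rewrite gt_eqF.
  rewrite mulrA ler_pdivrMr ?mulr_gt0 // mulrAC ler_wpM2r ?(ltW lna) //.
  by rewrite -!natrM ler_nat mulnC.
- by rewrite expR_gt1 mulr_gt0.
rewrite mulrC -ler_pdivrMr //; apply: le_trans (expR_ge1Dx _).
have : 96 / d / s < n%:R.
  by apply: lt_le_trans (truncnS_gt _) _; rewrite ler_nat (leq_trans _ n0n) ?leq_addl.
rewrite ltr_pdivrMr // mulrC -/d => h; lra.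
Qed.
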